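(* Let $\Gamma=(\mathcal N,(Y_i,u_i)_{i\in\mathcal N})$, $\mathcal{N}=\{1,\dots,N\}$, be a finite normal-form game that is a potential game. Let $\{\sigma(n)\}_{n\ge1}$ be a fictitious play process with asynchronous updates, with activity indicators $X_i(n)\in\{0,1\}$ and counts $N_i(n)=\sum_{s=1}^nX_i(s)$. Assume that (i) for each $i$, $\lim_{n\to\infty}N_i(n)=\infty$; and (ii) for all $i,j$, $\lim_{n\to\infty}N_i(n)/N_j(n)=1$. Then players learn Nash equilibrium strategies in the sense that $\lim_{n\to\infty}d(q(n),NE)=0$.
   Context: $Y_i$ is the finite action set of player $i$ and $u_i:\prod_jY_j\to\mathbb R$ the utility of player $i$. $\Delta(Y_i)$ is the set of probability distributions on $Y_i$ and $\Delta^N=\prod_i\Delta(Y_i)$. For $p\in\Delta^N$, $U_i(p)=\sum_yu_i(y)p_1(y_1)\cdots p_N(y_N)$; $p=(p_i,p_{-i})$, and $BR_i(p_{-i})=\arg\max_{p_i\in\Delta(Y_i)}U_i(p_i,p_{-i})$. $NE=\{p\in\Delta^N:U_i(p_i,p_{-i})\ge U_i(p_i',p_{-i})\ \forall p_i'\in\Delta(Y_i),\ \forall i\in\mathcal N\}$. $d(x,S)=\inf_{x'\in S}\|x-x'\|$ with the Euclidean norm. Potential game (Monderer–Shapley): there is a function $P:\prod_jY_j\to\mathbb R$ such that $u_i(y_i',y_{-i})-u_i(y_i,y_{-i})=P(y_i',y_{-i})-P(y_i,y_{-i})$ for all $i$, $y_i,y_i'\in Y_i$, $y_{-i}$. Asynchronous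 play. $\{X_i(n)\}_{n\ge1}$ are (deterministic or random) variables in $\{0,1\}$, $X_i(n)=1$ meaning that player $i$ is active in round $n$; $X_i(1)=1$ for all $i$. $\sigma_i(n)\in\Delta(Y_i)$ is the strategy of player $i$ in round $n$, and the empirical distribution of player $i$ is $$q_i(n)=\frac1{N_i(n)}\sum_{s=1}^n\sigma_i(s)X_i(s),\qquad q(n)=(q_1(n),\dots,q_N(n)).$$ $\{\sigma(n)\}_{n\ge1}$, $\sigma(n)=(\sigma_1(n),\dots,\sigma_N(n))$, is a fictitious play process with asynchronous updates if $\sigma_i(1)$ is arbitrary for all $i$ and, for all $n\ge1$ and all $i$: $\sigma_i(n+1)\in BR_i(q_{-i}(n))$ if $X_i(n+1)=1$, and $\sigma_i(n+1)=\sigma_i(n)$ otherwise. All (in)equalities and limits involving random quantities are understood almost surely. *)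

(* Defs.v *)
From HB Require Import structures.
From mathcomp Require Import all_boot all_order all_algebra.
From mathcomp Require Import all_classical all_reals all_analysis.
Import Order.TTheory GRing.Theory Num.Theory.
Import numFieldNormedType.Exports.

Set Implicit Arguments.
Unset Strict Implicit.
Unset Printing Implicit Defensive.

Local Open Scope classical_set_scope.
Local Open Scope ring_scope.

Section Game.
Context {R : realType} {N : nat} {Y : 'I_N -> finType}.

Definition pure_profile : predArgType := {dffun forall i, Y i}.

(* Families of real vectors indexed by the players; the mixed strategy
   profiles are those in [mixed_profiles] below. *)
Definition profile := forall i, {ffun Y i -> R}.

Definition simplex (T : finType) : set {ffun T -> R} :=
  [set p | (forall y, 0 <= p y) /\ \sum_y p y = 1].

Definition mixed_profiles : set profile := [set p | forall i, simplex (p i)].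

Definition play (y : pure_profile) (i : 'I_N) (a : Y i) : pure_profile :=
  finfun (dfwith (fun j => y j) i a).

Definition expected_utility (v : pure_profile -> R) (p : profile) : R :=
  \sum_(y : pure_profile) v y * \prod_j p j (y j).

Definition is_potential_game (u : 'I_N -> pure_profile -> R) : Prop :=
  exists P : pure_profile -> R, forall i (y : pure_profile) (a a' : Y i),
    u i (play y a') - u i (play y a) = P (play y a') - P (play y a).

(* The i-th component of p is overwritten, so this depends on p only through
   p_{-i}. *)
Definition best_response (u : 'I_N -> pure_profile -> R) (i : 'I_N)
    (p : profile) : set {ffun Y i -> R} :=
  [set s | simplex s /\ forall s', simplex s' ->
     expected_utility (u i) (dfwith p i s') <= expected_utility (u i) (dfwith p i s)].

Definition nash_equilibria (u : 'I_N -> pure_profile -> R) : set profile :=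
  [set p | mixed_profiles p /\ forall i s', simplex s' ->
     expected_utility (u i) (dfwith p i s') <= expected_utility (u i) p].

Definition euclidean_dist (p p' : profile) : R :=
  Num.sqrt (\sum_i \sum_(y : Y i) (p i y - p' i y) ^+ 2).

(* Extended-real infimum: the distance to the empty set is +oo, whereas the
   real-valued [inf] would give 0. *)
Definition dist_to_set (p : profile) (S : set profile) : \bar R :=
  ereal_inf [set (euclidean_dist p p')%:E | p' in S].

End Game.

Arguments pure_profile {N} Y.
Arguments profile R {N} Y.

(* Rounds are numbered from 1: the values of X and sigma at 0 are never used. *)
Section AsynchronousPlay.
Context {R : realType} {N : nat} {Y : 'I_N -> finType}.

Definition activity_count (X : 'I_N -> nat -> bool) (i : 'I_N) (n : nat) : nat :=
  (\sum_(1 <= s < n.+1) X i s)%N.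

Definition empirical (X : 'I_N -> nat -> bool) (sigma : nat -> profile R Y)
    (n : nat) : profile R Y :=
  fun i => (activity_count X i n)%:R^-1 *:
    \sum_(1 <= s < n.+1) (X i s)%:R *: sigma s i.

Definition async_fictitious_play (u : 'I_N -> pure_profile Y -> R)
    (X : 'I_N -> nat -> bool) (sigma : nat -> profile R Y) : Prop :=
  (forall n, (1 <= n)%N -> mixed_profiles (sigma n)) /\
  (forall n i, (1 <= n)%N ->
     if X i n.+1 then best_response u (empirical X sigma n) (sigma n.+1 i)
     else sigma n.+1 i = sigma n i).

End AsynchronousPlay.

(* Main.v *)
Require Import Defs.
From HB Require Import structures.
From mathcomp Require Import all_boot all_order all_algebra.
From mathcomp Require Import all_classical all_reals all_analysis.
From mathcomp Require Import ring lra.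
Import Order.TTheory GRing.Theory Num.Theory.
Import numFieldNormedType.Exports.

Set Implicit Arguments.
Unset Strict Implicit.
Unset Printing Implicit Defensive.

Local Open Scope classical_set_scope.
Local Open Scope ring_scope.

(** Along fictitious play in a potential game the potential [P] is almost
increasing, and this forces every unilateral gain to die out.

Write q(n) for the empirical profile, N_i(n) for the number of rounds in which
player i has been active, and g_i(n+1) = X_i(n+1) / N_i(n+1).  Then
q_i(n+1) = q_i(n) + g_i(n+1) (sigma_i(n+1) - q_i(n)).  Since the expected
potential is affine in each coordinate and Lipschitz, one round changes it by
sum_i g_i(n+1) D_i(n), up to an error of order sum_i g_i(n+1)^2, where D_i(n) is
the gain in potential if player i alone switches from q_i(n) to sigma_i(n+1)
([potential_step_ge]).  Because g_i(n+1)^2 <= 1/N_i(n) - 1/N_i(n+1), the error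
telescopes, so that
  V(n) = (expected potential at q(n)) - C sum_i 1/N_i(n)
satisfies V(n+1) - V(n) >= sum_i g_i(n+1) D_i(n) ([lyapunov_increment]).  An
active player best-responds, and in a potential game the gain in utility is the
gain in potential ([potential_deviation_gain]); hence D_i(n) >= 0 whenever i is
active, and V is nondecreasing.  Being bounded above, V is a Cauchy sequence.

Suppose that at arbitrarily late rounds n some deviation of player i gains more
than eps.  Look at the rounds following n until N_i has grown by a factor
1 + delta.  As all the ratios N_j/N_i tend to 1, every N_j grows by a factor
close to 1 + delta on this window, so no q_j moves by more than O(delta), and
for small delta the deviation still gains at least eps/2 throughout.  Player i's
step sizes on the window sum to at least delta/(1 + delta), so V increases by at
least (eps/2) delta/(1 + delta), which contradicts the Cauchy property.  This is
[gain_vanishes], the only place where the asymptotic equality of the activity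
counts is needed.

Finally a set of late rounds on which q(n) stays away from the equilibria would,
by compactness, have a cluster point; all unilateral gains vanish there, so the
cluster point is itself an equilibrium ([gain_vanishing_dist_nash]).  The
probability space only enters through the intersection of almost sure events. *)

(** * Expected utility as a multilinear function *)

Lemma norm_prodr_le1 (R : realType) (I : Type) (r : seq I) (a : I -> R) :
  (forall i, `|a i| <= 1) -> `|\prod_(i <- r) a i| <= 1.
Proof.
move=> ha; rewrite normr_prod; apply: prodr_ile1 => i _.
by rewrite normr_ge0 ha.
Qed.

Lemma ler_norm_prodrB (R : realType) (I : Type) (r : seq I) (a b : I -> R) :
    (forall i, `|a i| <= 1) -> (forall i, `|b i| <= 1) ->
  `|\prod_(i <- r) a i - \prod_(i <- r) b i| <= \sum_(i <- r) `|a i - b i|.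
Proof.
move=> ha hb; elim: r => [|i r IH]; first by rewrite !big_nil subrr normr0.
rewrite !big_cons.
set A := \prod_(j <- r) a j in IH *; set B := \prod_(j <- r) b j in IH *.
have -> : a i * A - b i * B = (a i - b i) * A + b i * (A - B) by ring.
apply: le_trans (ler_normD _ _) _; rewrite !normrM; apply: lerD.
  by rewrite ler_piMr ?norm_prodr_le1.
by apply: le_trans IH; rewrite ler_piMl.
Qed.

Section ExpectedUtility.
Context {R : realType} {N : nat} {Y : 'I_N -> finType}.
Implicit Types (v w P : pure_profile Y -> R) (p q : profile R Y).

(** A condition weaker than being a mixed profile that is enough for the
Lipschitz estimates. *)
Definition unit_bounded p := forall i y, `|p i y| <= 1.

Definition deviation_gain v p i (s : {ffun Y i -> R}) : R :=
  expected_utility v (dfwith p i s) - expected_utility v p.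

Definition utility_mass v : R := \sum_y `|v y|.

Lemma utility_mass_ge0 v : 0 <= utility_mass v.
Proof. exact: sumr_ge0. Qed.

Lemma dfwith_self p i : dfwith p i (p i) = p.
Proof. by apply: functional_extensionality_dep => j; case: dfwithP. Qed.

Lemma simplex_le1 (T : finType) (s : {ffun T -> R}) y :
  simplex s -> s y <= 1.
Proof.
by case=> s0 <-; rewrite (bigD1 y) //= lerDl sumr_ge0.
Qed.

Lemma simplex_norm_le1 (T : finType) (s : {ffun T -> R}) y :
  simplex s -> `|s y| <= 1.
Proof. by move=> hs; rewrite ger0_norm ?simplex_le1//; case: hs. Qed.

Lemma unit_bounded_mixed p : mixed_profiles p -> unit_bounded p.
Proof. by move=> hp i y; exact: simplex_norm_le1. Qed.

Lemma unit_bounded_dfwith p i (s : {ffun Y i -> R}) :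
  unit_bounded p -> simplex s -> unit_bounded (dfwith p i s).
Proof.
move=> hp hs j; case: dfwithP => [|k _] y; last exact: hp.
exact: simplex_norm_le1.
Qed.

Lemma expected_utility_norm v p :
  unit_bounded p -> `|expected_utility v p| <= utility_mass v.
Proof.
move=> hp; apply: le_trans (ler_norm_sum _ _ _) _; apply: ler_sum => y _.
by rewrite normrM ler_piMr // norm_prodr_le1.
Qed.

Lemma expected_utility_lipschitz v p q (delta : 'I_N -> R) :
    unit_bounded p -> unit_bounded q ->
    (forall i y, `|p i y - q i y| <= delta i) ->
  `|expected_utility v p - expected_utility v q|
    <= utility_mass v * \sum_i delta i.
Proof.
move=> hp hq hd; rewrite /expected_utility -sumrB.
apply: le_trans (ler_norm_sum _ _ _) _.
rewrite /utility_mass mulr_suml; apply: ler_sum => y _.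
rewrite -mulrBr normrM ler_wpM2l //.
apply: le_trans (ler_norm_prodrB _ _ _) _ => //.
by apply: ler_sum => i _; exact: hd.
Qed.

Lemma deviation_gain_lipschitz v p q i (s : {ffun Y i -> R})
    (delta : 'I_N -> R) :
    unit_bounded p -> unit_bounded q -> simplex s ->
    (forall i y, `|p i y - q i y| <= delta i) ->
  `|deviation_gain v p s - deviation_gain v q s|
    <= 2 * utility_mass v * \sum_i delta i.
Proof.
move=> hp hq hs hd; rewrite /deviation_gain.
have hd' j y : `|dfwith p i s j y - dfwith q i s j y| <= delta j.
  have [ij|ij] := eqVneq i j; last by rewrite !dfwithout.
  case: j / ij y => y; rewrite !dfwithin subrr normr0.
  exact: le_trans (hd i y).
have hps := unit_bounded_dfwith hp hs; have hqs := unit_bounded_dfwith hq hs.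
have := expected_utility_lipschitz v hp hq hd.
have := expected_utility_lipschitz v hps hqs hd'.
rewrite !ler_norml; lra.
Qed.

Lemma expected_utility_dfwith v p i (s : {ffun Y i -> R}) :
  expected_utility v (dfwith p i s) =
    \sum_y v y * (s (y i) * \prod_(j | j != i) p j (y j)).
Proof.
apply: eq_bigr => y _; rewrite (bigD1 i) //= dfwithin; do 2 congr (_ * _).
by apply: eq_bigr => j ji; rewrite dfwithout // eq_sym.
Qed.

Lemma expected_utility_mix v p i (s a b : {ffun Y i -> R}) (c : R) :
    (forall y, s y = (1 - c) * a y + c * b y) ->
  expected_utility v (dfwith p i s) =
    (1 - c) * expected_utility v (dfwith p i a) +
    c * expected_utility v (dfwith p i b).
Proof.
move=> hs; rewrite !expected_utility_dfwith !mulr_sumr -big_split /=.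
by apply: eq_bigr => y _; rewrite hs; ring.
Qed.

Lemma play_in (y : pure_profile Y) i (a : Y i) : play y a i = a.
Proof. by rewrite /play ffunE dfwithin. Qed.

Lemma play_out (y : pure_profile Y) i (a : Y i) j :
  i != j -> play y a j = y j.
Proof. by move=> ij; rewrite /play ffunE dfwithout. Qed.

Lemma play_playK (y : pure_profile Y) i (a : Y i) : play (play y a) (y i) = y.
Proof.
apply/ffunP => j; have [ij|ij] := eqVneq i j; last by rewrite !play_out.
by case: j / ij; rewrite play_in.
Qed.

Lemma play_self (y : pure_profile Y) i : play y (y i) = y.
Proof.
apply/ffunP => j; have [ij|ij] := eqVneq i j; last by rewrite play_out.
by case: j / ij; rewrite play_in.
Qed.

(** Both sides double to the sum over pairs of a pure profile y and an action b
of a weight that ignores y_i, times s(y_i) s'(b): multiply either side by the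
total mass 1 of the other strategy.  Exchanging y_i and b is an involution on
these pairs that swaps the roles of s and s'. *)
Lemma expected_utility_insensitive w p i (s s' : {ffun Y i -> R}) :
    (forall y (a a' : Y i), w (play y a) = w (play y a')) ->
    \sum_a s a = 1 -> \sum_a s' a = 1 ->
  expected_utility w (dfwith p i s) = expected_utility w (dfwith p i s').
Proof.
move=> hw.
have wE y (a : Y i) : w (play y a) = w y by rewrite (hw y a (y i)) play_self.
pose A (y : pure_profile Y) := w y * \prod_(j | j != i) p j (y j).
have AE y (a : Y i) : A (play y a) = A y.
  rewrite /A wE; congr (_ * _); apply: eq_bigr => j ji.
  by rewrite play_out // eq_sym.
have dbl (t t' : {ffun Y i -> R}) : \sum_a t' a = 1 ->
    expected_utility w (dfwith p i t) =
    \sum_(z : pure_profile Y * Y i) A z.1 * t (z.1 i) * t' z.2.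
  move=> ht'; rewrite expected_utility_dfwith.
  rewrite -(pair_bigA _ (fun y b => A y * t (y i) * t' b)) /=.
  by apply: eq_bigr => y _; rewrite -mulr_sumr ht' /A; ring.
move=> hs hs'; rewrite (dbl s s') // (dbl s' s) //.
pose swap (z : pure_profile Y * Y i) := (play z.1 z.2, z.1 i).
have swapK : involutive swap.
  by case=> y b; rewrite /swap /= play_playK play_in.
rewrite (reindex_inj (inv_inj swapK)) /=.
by apply: eq_bigr => -[y b] _; rewrite /= AE play_in; ring.
Qed.

(** The difference of the utility of player i and the potential does not depend
on the action of player i, so its expectation is unaffected by a deviation. *)
Lemma potential_deviation_gain (u : 'I_N -> pure_profile Y -> R) P p i
    (s : {ffun Y i -> R}) :
    (forall y (a a' : Y i),
       u i (play y a') - u i (play y a) = P (play y a') - P (play y a)) ->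
    mixed_profiles p -> simplex s ->
  deviation_gain (u i) p s = deviation_gain P p s.
Proof.
move=> hP hp hs; rewrite /deviation_gain -{2 4}(dfwith_self p i).
have euB q : expected_utility (fun y => u i y - P y) q =
    expected_utility (u i) q - expected_utility P q.
  by rewrite /expected_utility -sumrB; apply: eq_bigr => y _; rewrite mulrBl.
have := @expected_utility_insensitive (fun y => u i y - P y) p i s (p i).
rewrite !euB => h; suff : expected_utility (u i) (dfwith p i s) -
    expected_utility P (dfwith p i s) =
    expected_utility (u i) (dfwith p i (p i)) -
    expected_utility P (dfwith p i (p i)) by lra.
apply: h; [|by case: hs|by case: (hp i)].
by move=> y a a'; have := hP y a a'; lra.
Qed.

End ExpectedUtility.

(** * One simultaneous update of all the players *)

Section PotentialStep.
Context {R : realType} {N : nat} {Y : 'I_N -> finType}.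
Implicit Types (v : pure_profile Y -> R) (p q : profile R Y).

Lemma simplex_mix (T : finType) (s a b : {ffun T -> R}) (c : R) :
    0 <= c <= 1 -> simplex a -> simplex b ->
    (forall y, s y = (1 - c) * a y + c * b y) -> simplex s.
Proof.
move=> /andP[c0 c1] [a0 a1] [b0 b1] hs; split.
  by move=> y; rewrite hs addr_ge0 // mulr_ge0 // subr_ge0.
under eq_bigr do rewrite hs.
by rewrite big_split /= -!mulr_sumr a1 b1; ring.
Qed.

Lemma simplex_mix_dist (T : finType) (s a b : {ffun T -> R}) (c : R) y :
    0 <= c -> simplex a -> simplex b ->
    s y = (1 - c) * a y + c * b y -> `|s y - a y| <= c.
Proof.
move=> c0 ha hb ->.
have -> : (1 - c) * a y + c * b y - a y = c * (b y - a y) by ring.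
rewrite normrM ger0_norm // ler_piMr // ler_norml.
have [a0 _] := ha; have [b0 _] := hb.
have := simplex_le1 y ha; have := simplex_le1 y hb.
have := a0 y; have := b0 y; lra.
Qed.

Lemma sqr_sum_le (g : 'I_N -> R) :
  (\sum_i g i) ^+ 2 <= N%:R * \sum_i g i ^+ 2.
Proof.
have -> : N%:R * \sum_i g i ^+ 2 =
    \sum_i \sum_j ((g i ^+ 2 + g j ^+ 2) / 2).
  transitivity (\sum_(i < N) (N%:R * g i ^+ 2 / 2 + (\sum_j g j ^+ 2) / 2)).
    rewrite big_split /= sumr_const card_ord -!mulr_suml -mulr_sumr -mulr_natl.
    by field.
  apply: eq_bigr => i _; rewrite -mulr_suml big_split /= sumr_const card_ord.
  by rewrite -[_ *+ N]mulr_natl; field.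
rewrite expr2 mulr_suml; apply: ler_sum => i _.
rewrite mulr_sumr; apply: ler_sum => j _.
have := sqr_ge0 (g i - g j); rewrite !expr2; nra.
Qed.

(** The players are updated one after the other through the hybrid profiles
[h k], in which the first k players have moved.  Updating player k changes the
expected potential by exactly [g k] times a gain evaluated at [h k]; moving the
evaluation point back to [q] costs a Lipschitz constant times [g k * \sum_i g i],
and these errors add up to the square of the total step. *)
Lemma potential_step_ge v (q q' s : profile R Y) (g : 'I_N -> R) :
    mixed_profiles q -> mixed_profiles s -> (forall i, 0 <= g i <= 1) ->
    (forall i y, q' i y = (1 - g i) * q i y + g i * s i y) ->
  \sum_i g i * deviation_gain v q (s i)
    - 2 * utility_mass v * N%:R * \sum_i g i ^+ 2
    <= expected_utility v q' - expected_utility v q.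
Proof.
move=> hq hs hg hq'.
have hmq' : mixed_profiles q'.
  by move=> i; apply: (simplex_mix (hg i) (hq i) (hs i)); exact: hq'.
pose h (k : nat) : profile R Y := fun i => if (i < k)%N then q' i else q i.
have hh k : unit_bounded (h k).
  by apply: unit_bounded_mixed => i; rewrite /h; case: ifP.
have h0 : h 0%N = q by apply: functional_extensionality_dep => i.
have hN : h N = q'.
  by apply: functional_extensionality_dep => i; rewrite /h ltn_ord.
have hS (k : 'I_N) : h k.+1 = dfwith (h k) k (q' k).
  apply: functional_extensionality_dep => i; case: dfwithP => [|j kj].
    by rewrite /h ltnSn.
  rewrite /h ltnS leq_eqVlt; case: eqP => //= e.
  by move: kj; rewrite (ord_inj e) eqxx.
have hk (k : 'I_N) : h k = dfwith (h k) k (q k).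
  rewrite -[LHS](dfwith_self _ k); congr dfwith.
  by rewrite /h ltnn.
have hdist k i y : `|h k i y - q i y| <= g i.
  rewrite /h; case: ifP => _.
    by apply: (simplex_mix_dist _ (hq i) (hs i) (hq' i y)); case/andP: (hg i).
  by rewrite subrr normr0; case/andP: (hg i).
rewrite -h0 -hN -(telescope_sumr (fun k => expected_utility v (h k))) //.
rewrite big_mkord h0.
have hterm (k : 'I_N) :
    g k * deviation_gain v q (s k) - 2 * utility_mass v * (g k * \sum_i g i)
    <= expected_utility v (h k.+1) - expected_utility v (h k).
  have -> : expected_utility v (h k.+1) - expected_utility v (h k) =
      g k * deviation_gain v (h k) (s k).
    rewrite hS (expected_utility_mix v (h k) (hq' k)) -hk /deviation_gain; ring.
  have := deviation_gain_lipschitz v (hh k) (unit_bounded_mixed hq) (hs k)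
    (hdist k).
  rewrite ler_norml => /andP[hlo _].
  have /andP[g0 _] := hg k.
  have := ler_wpM2l g0 hlo; lra.
apply: le_trans (ler_sum _ (fun k _ => hterm k)).
rewrite sumrB lerD2l lerN2 -mulr_sumr -mulr_suml -mulrA.
rewrite ler_wpM2l ?mulr_ge0 ?utility_mass_ge0 // -expr2.
exact: sqr_sum_le.
Qed.

End PotentialStep.

(** * Recursion for the empirical strategies *)

Section EmpiricalRecursion.
Context {R : realType} {N : nat} {Y : 'I_N -> finType}.
Variables (X : 'I_N -> nat -> bool) (sigma : nat -> profile R Y).

Notation cnt i n := ((activity_count X i n)%:R : R).

Definition step_size i n : R := (X i n)%:R / cnt i n.

Lemma activity_countS i n :
  activity_count X i n.+1 = (activity_count X i n + X i n.+1)%N.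
Proof. by rewrite /activity_count big_nat_recr. Qed.

Lemma activity_count_le i n m :
  (n <= m)%N -> (activity_count X i n <= activity_count X i m)%N.
Proof.
elim: m => [|m IH]; first by rewrite leqn0 => /eqP ->.
rewrite leq_eqVlt => /predU1P[-> //|/IH h].
by rewrite activity_countS (leq_trans h) // leq_addr.
Qed.

Hypothesis hX1 : forall i, X i 1%N.

Lemma activity_count_gt0 i n : (1 <= n)%N -> (0 < activity_count X i n)%N.
Proof.
move=> n1; apply: leq_trans (activity_count_le i n1).
by rewrite /activity_count big_nat1 hX1.
Qed.

Lemma cnt_gt0 i n : (1 <= n)%N -> 0 < cnt i n.
Proof. by move=> n1; rewrite ltr0n activity_count_gt0. Qed.

Lemma step_sizeE i n :
  step_size i n.+1 = (cnt i n.+1 - cnt i n) / cnt i n.+1.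
Proof. by rewrite /step_size {2}activity_countS natrD addrAC subrr add0r. Qed.

Lemma step_size_bounds i n : (1 <= n)%N -> 0 <= step_size i n.+1 <= 1.
Proof.
move=> n1; rewrite /step_size divr_ge0 //= ler_pdivrMr ?cnt_gt0 // mul1r ler_nat.
by rewrite activity_countS leq_addl.
Qed.

(** When the player is active the two counts are c and c + 1, and
1/(c+1)^2 <= 1/(c (c+1)); the right-hand side telescopes, which makes the squared
steps summable however rarely the player is active. *)
Lemma step_size_sqr i n : (1 <= n)%N ->
  step_size i n.+1 ^+ 2 <= (cnt i n)^-1 - (cnt i n.+1)^-1.
Proof.
move=> n1; have c0 := cnt_gt0 i n1; have c1 : 0 < cnt i n.+1 by exact: cnt_gt0.
rewrite /step_size; move: c1; rewrite activity_countS.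
case: (X i n.+1); last by rewrite addn0 mul0r expr0n /= subrr.
rewrite natrD /= => c1; set c := cnt i n in c0 c1 *.
have -> : c^-1 - (c + 1)^-1 = (c * (c + 1))^-1.
  by field; rewrite (gt_eqF c0) gt_eqF.
rewrite div1r exprVn lef_pV2 ?posrE ?mulr_gt0 ?exprn_gt0 // expr2.
by rewrite ler_wpM2r ?(ltW c1) // lerDl.
Qed.

Lemma empiricalS i n y : (1 <= n)%N ->
  empirical X sigma n.+1 i y =
    (1 - step_size i n.+1) * empirical X sigma n i y
    + step_size i n.+1 * sigma n.+1 i y.
Proof.
move=> n1; have c0 := cnt_gt0 i n1; have c1 : 0 < cnt i n.+1 by exact: cnt_gt0.
have scE (a : R) (f : {ffun Y i -> R}) : (a *: f) y = a * f y by rewrite ffunE.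
rewrite /empirical /step_size big_nat_recr //= !scE.
rewrite (ffunE (fun z => _ + _)) scE.
set S := (\sum_(_ <= _ < _) _ : {ffun _}) y.
move: c1; rewrite activity_countS.
case: (X i n.+1) => /=; last first.
  by rewrite addn0 !mul0r subr0 mul1r !addr0.
rewrite natrD /= => c1.
set c := cnt i n in c0 c1 *; rewrite mul1r; field.
by rewrite (gt_eqF c0) gt_eqF.
Qed.

Hypothesis hmix : forall n, (1 <= n)%N -> mixed_profiles (sigma n).

Lemma empirical_mixed n : (1 <= n)%N -> mixed_profiles (empirical X sigma n).
Proof.
case: n => // n _; elim: n => [|n IH] i.
  rewrite /empirical /activity_count !big_nat1 hX1 invr1 !scale1r.
  exact: hmix.
apply: (simplex_mix (step_size_bounds i _) (IH i) (hmix _ i)).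
- exact: (ltn0Sn n).
- exact: (ltn0Sn n.+1).
- by move=> y; exact: empiricalS.
Qed.

(** Each step moves q_i by at most (N_i(k+1) - N_i(k)) / N_i(k+1), and the
denominator is bounded below by N_i(n).  Only the growth factor of N_i matters,
not the number of rounds elapsed. *)
Lemma empirical_move i n m y : (1 <= n)%N -> (n <= m)%N ->
  `|empirical X sigma m i y - empirical X sigma n i y|
    <= cnt i m / cnt i n - 1.
Proof.
move=> n1; elim: m => [|m IH].
  by move=> h; move: (leq_trans n1 h).
rewrite leq_eqVlt => /predU1P[<-|nm].
  by rewrite subrr normr0 divff ?subrr // gt_eqF ?cnt_gt0.
rewrite ltnS in nm; have m1 := leq_trans n1 nm.
have hm := IH nm.
have hd : `|empirical X sigma m.+1 i y - empirical X sigma m i y|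
    <= step_size i m.+1.
  apply: simplex_mix_dist (empirical_mixed m1 i) (hmix (ltn0Sn m) i) _.
    by case/andP: (step_size_bounds i m1).
  exact: empiricalS.
have hs : step_size i m.+1 <= (cnt i m.+1 - cnt i m) / cnt i n.
  rewrite step_sizeE ler_wpM2l ?subr_ge0 ?ler_nat ?activity_count_le //.
  rewrite lef_pV2 ?posrE ?cnt_gt0 // ler_nat activity_count_le //.
  exact: leq_trans nm _.
have -> : cnt i m.+1 / cnt i n - 1 =
    (cnt i m.+1 - cnt i m) / cnt i n + (cnt i m / cnt i n - 1) by ring.
rewrite -(subrKA (empirical X sigma m i y)).
apply: le_trans (ler_normD _ _) _.
by apply: lerD => //; apply: le_trans hs.
Qed.

End EmpiricalRecursion.

(** * The Lyapunov function and vanishing gains *)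

Section FictitiousPlay.
Context {R : realType} {N : nat} {Y : 'I_N -> finType}.
Variables (u : 'I_N -> pure_profile Y -> R) (P : pure_profile Y -> R).
Variables (X : 'I_N -> nat -> bool) (sigma : nat -> profile R Y).
Hypothesis hP : forall i (y : pure_profile Y) (a a' : Y i),
  u i (play y a') - u i (play y a) = P (play y a') - P (play y a).
Hypothesis hX1 : forall i, X i 1%N.
Hypothesis hfp : async_fictitious_play u X sigma.

Notation q := (empirical X sigma).
Notation cnt i n := ((activity_count X i n)%:R : R).

Let hmix : forall n, (1 <= n)%N -> mixed_profiles (sigma n).
Proof. by case: hfp. Qed.

Lemma active_gain_ge n i (s : {ffun Y i -> R}) :
    (1 <= n)%N -> X i n.+1 -> simplex s ->
  deviation_gain P (q n) s <= deviation_gain P (q n) (sigma n.+1 i).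
Proof.
move=> n1 hX hs; have hq := empirical_mixed hX1 hmix n1.
have := hfp.2 n i n1; rewrite hX => -[hsig hbr].
rewrite -!(potential_deviation_gain (@hP i)) // lerD2r.
exact: hbr.
Qed.

Lemma active_gain_ge0 n i :
    (1 <= n)%N -> X i n.+1 -> 0 <= deviation_gain P (q n) (sigma n.+1 i).
Proof.
move=> n1 hX; have := active_gain_ge n1 hX (empirical_mixed hX1 hmix n1 i).
by rewrite {1}/deviation_gain dfwith_self subrr.
Qed.

(** The correction term pays for the second-order error of
[potential_step_ge], by [step_size_sqr]. *)
Definition lyapunov n : R :=
  expected_utility P (q n)
  - 2 * utility_mass P * N%:R * \sum_i (cnt i n)^-1.

(** All the terms g_j D_j of the other players are nonnegative and may be
dropped; for player i, an arbitrary strategy [s] gains at most as much as the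
best response that was played.  Stating the bound for every [s], also in rounds
where i is inactive, avoids introducing the maximal gain. *)
Lemma lyapunov_increment n i (s : {ffun Y i -> R}) :
    (1 <= n)%N -> simplex s ->
  step_size X i n.+1 * deviation_gain P (q n) s
    <= lyapunov n.+1 - lyapunov n.
Proof.
move=> n1 hs; have hq := empirical_mixed hX1 hmix n1.
have hg j := step_size_bounds (R := R) hX1 j n1.
have := potential_step_ge P hq (hmix (ltn0Sn n)) hg
  (fun j y => empiricalS sigma hX1 y n1).
have hnn j : 0 <= step_size X j n.+1 * deviation_gain P (q n) (sigma n.+1 j).
  rewrite /step_size; case hX : (X j n.+1); last by rewrite !mul0r.
  by rewrite mulr_ge0 ?divr_ge0 // active_gain_ge0.
have hi : step_size X i n.+1 * deviation_gain P (q n) s <=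
    \sum_j step_size X j n.+1 * deviation_gain P (q n) (sigma n.+1 j).
  rewrite (bigD1 i) //= -[leLHS]addr0 lerD ?sumr_ge0 //.
  rewrite /step_size; case hX : (X i n.+1); last by rewrite !mul0r.
  by rewrite ler_wpM2l ?divr_ge0 // active_gain_ge.
have hsq : 2 * utility_mass P * N%:R * \sum_j step_size X j n.+1 ^+ 2 <=
    2 * utility_mass P * N%:R *
    (\sum_j (cnt j n)^-1 - \sum_j (cnt j n.+1)^-1).
  rewrite ler_wpM2l ?mulr_ge0 ?utility_mass_ge0 // -sumrB.
  by apply: ler_sum => j _; exact: step_size_sqr.
rewrite /lyapunov; lra.
Qed.

Lemma lyapunov_nondecreasing n : 'I_N -> (1 <= n)%N ->
  lyapunov n <= lyapunov n.+1.
Proof.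
move=> i n1; rewrite -subr_ge0.
have := lyapunov_increment n1 (empirical_mixed hX1 hmix n1 i).
by rewrite /deviation_gain dfwith_self subrr mulr0.
Qed.

Lemma lyapunov_cauchy (eta : R) : 'I_N -> 0 < eta ->
  exists2 n0, (1 <= n0)%N &
    forall n m, (n0 <= n)%N -> (n <= m)%N -> lyapunov m - lyapunov n < eta.
Proof.
move=> i0 eta0.
pose w n := lyapunov n.+1.
have wmono : {homo w : n m / (n <= m)%N >-> n <= m}.
  by apply/nondecreasing_seqP => n; exact: lyapunov_nondecreasing.
have wbnd : has_ubound (range w).
  exists (utility_mass P) => _ [n _ <-]; rewrite /w /lyapunov.
  have := expected_utility_norm P
    (unit_bounded_mixed (empirical_mixed hX1 hmix (ltn0Sn n))).
  rewrite ler_norml => /andP[_ h]; apply: le_trans h.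
  rewrite gerBl; apply: mulr_ge0; first by rewrite !mulr_ge0 ?utility_mass_ge0.
  by apply: sumr_ge0 => j _; rewrite invr_ge0.
have wcvg := nondecreasing_is_cvgn wmono wbnd.
have wle := nondecreasing_cvgn_le wmono wcvg.
have /cvgrPdist_lt/(_ _ eta0) := wcvg.
case=> n0 _ hn0; exists n0.+1 => // -[//|n] [//|m] hn hm.
have hln : `|limn w - w n| < eta by exact: hn0.
have := wle m; rewrite -/(w n) -/(w m); move: hln; rewrite ltr_norml => /andP[_].
lra.
Qed.

Hypothesis hcount : forall i A, exists n, (A < activity_count X i n)%N.
Hypothesis hratio : forall (delta : R) i j, 0 < delta ->
  \forall n \near \oo, cnt i n <= (1 + delta) * cnt j n.

(** The window argument: a gain exceeding [eps] at a late round persists, at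
half its size, until N_i has grown by the factor 1 + [delta], and meanwhile the
Lyapunov function grows by more than the Cauchy property allows. *)
Lemma gain_vanishes i (eps : R) : 0 < eps ->
  \forall n \near \oo, forall s : {ffun Y i -> R}, simplex s ->
    deviation_gain P (q n) s <= eps.
Proof.
move=> eps0.
have M0 := utility_mass_ge0 P.
(* On the window every N_j grows by at most (1 + delta)^3 <= 1 + 7 delta, so the
   gain changes by at most 2 * mass * N * (7 delta) = K delta / 2 <= eps / 2. *)
set K := 28 * utility_mass P * N%:R.
have K0 : 0 <= K by rewrite !mulr_ge0.
pose delta := eps / (eps + K).
have eK0 : 0 < eps + K by lra.
have delta0 : 0 < delta by rewrite divr_gt0.
have delta1 : delta <= 1 by rewrite ler_pdivrMr // mul1r; lra.
have Kdelta : K * delta <= eps.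
  by rewrite /delta mulrA ler_pdivrMr //; nra.
pose eta := eps / 2 * (delta / (1 + delta)).
have eta0 : 0 < eta by rewrite mulr_gt0 ?divr_gt0 //; lra.
have [n1 n10 hlyap] := lyapunov_cauchy i eta0.
have h1 : \forall n \near \oo, forall j, cnt j n <= (1 + delta) * cnt i n.
  by apply: filter_forall => j; exact: hratio.
have h2 : \forall n \near \oo, forall j, cnt i n <= (1 + delta) * cnt j n.
  by apply: filter_forall => j; exact: hratio.
have := filterI h1 h2; case=> n2 _ h12.
exists (maxn n1 n2) => // n /= hn s hs.
have [hn1 hn2] : (n1 <= n /\ n2 <= n)%N by move: hn; rewrite geq_max => /andP.
have n_ge1 : (1 <= n)%N by exact: leq_trans hn1.
rewrite leNgt; apply/negP => hgt.
have ci0 : 0 < cnt i n by exact: cnt_gt0.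
have exm : exists m, (1 + delta) * cnt i n < cnt i m.
  have [m hm] := hcount i (2 * activity_count X i n); exists m.
  apply: le_lt_trans (_ : (2 * activity_count X i n)%:R < _).
    by rewrite natrM ler_wpM2r //; lra.
  by rewrite ltr_nat.
(* The window is the set of rounds k with n <= k < m. *)
have [m hm hmin] := ex_minnP exm.
have nm : (n <= m)%N.
  rewrite leqNgt; apply/negP => mn; move: hm; apply/negP; rewrite -leNgt.
  have : cnt i m <= cnt i n by rewrite ler_nat activity_count_le // ltnW.
  nra.
have hwin k : (n <= k)%N -> (k < m)%N -> eps / 2 <= deviation_gain P (q k) s.
  move=> nk km.
  have k_ge1 := leq_trans n_ge1 nk.
  have [hk1 _] := h12 _ (leq_trans hn2 nk).
  have [_ hn2'] := h12 _ hn2.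
  have hik : cnt i k <= (1 + delta) * cnt i n.
    by rewrite leNgt; apply/negP => /hmin; rewrite leqNgt km.
  have hd j y : `|q k j y - q n j y| <= 7 * delta.
    apply: le_trans (empirical_move hX1 hmix y n_ge1 nk) _.
    have cj0 : 0 < cnt j n by exact: cnt_gt0.
    rewrite lerBlDr ler_pdivrMr //.
    have e1 := hk1 j; have e2 := hn2' j.
    have d3 : (1 + delta) * ((1 + delta) * (1 + delta)) <= 7 * delta + 1 by nra.
    apply: le_trans e1 _; apply: le_trans (_ : (1 + delta) *
      ((1 + delta) * ((1 + delta) * cnt j n)) <= _).
      rewrite ler_wpM2l ?addr_ge0 ?(ltW delta0) //; apply: le_trans hik _.
      by rewrite ler_wpM2l ?addr_ge0 ?(ltW delta0).
    have := ler_wpM2r (ltW cj0) d3; lra.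
  have := deviation_gain_lipschitz P
    (unit_bounded_mixed (empirical_mixed hX1 hmix k_ge1))
    (unit_bounded_mixed (empirical_mixed hX1 hmix n_ge1)) hs hd.
  rewrite sumr_const card_ord -[_ *+ N]mulr_natl ler_norml => /andP[hlo _].
  have : 2 * utility_mass P * (N%:R * (7 * delta)) = K * delta / 2.
    by rewrite /K; field.
  lra.
have hgrow k : (n <= k)%N -> (k <= m)%N ->
    eps / 2 * ((cnt i k - cnt i n) / cnt i m) <= lyapunov k - lyapunov n.
  elim: k => [|k IH]; first by move=> /(leq_trans n_ge1).
  rewrite leq_eqVlt => /predU1P[<- _|nk km]; first by rewrite !subrr mul0r mulr0.
  rewrite ltnS in nk; have k_ge1 := leq_trans n_ge1 nk.
  have {IH}hk := IH nk (ltnW km).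
  have hinc := lyapunov_increment k_ge1 hs.
  have hst : (cnt i k.+1 - cnt i k) / cnt i m <= step_size X i k.+1.
    rewrite step_sizeE ler_wpM2l ?subr_ge0 ?ler_nat ?activity_count_le //.
    rewrite lef_pV2 ?posrE ?cnt_gt0 // ?ler_nat ?activity_count_le //.
    exact: leq_trans nm.
  have hw := hwin _ nk km.
  have hst0 : 0 <= (cnt i k.+1 - cnt i k) / cnt i m.
    by rewrite divr_ge0 // subr_ge0 ler_nat activity_count_le.
  have -> : (cnt i k.+1 - cnt i n) / cnt i m =
      (cnt i k.+1 - cnt i k) / cnt i m + (cnt i k - cnt i n) / cnt i m.
    by rewrite -mulrDl subrKA.
  nra.
have := hgrow m nm (leqnn m); have := hlyap n m hn1 nm.
have cm0 : 0 < cnt i m by apply: cnt_gt0 => //; exact: leq_trans nm.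
suff : delta / (1 + delta) <= (cnt i m - cnt i n) / cnt i m.
  rewrite /eta; nra.
rewrite ler_pdivlMr // mulrAC ler_pdivrMr; last by lra.
lra.
Qed.

End FictitiousPlay.

(** * Vanishing gains and convergence to the equilibria *)

Section NashLimit.
Context {R : realType} {N : nat} {Y : 'I_N -> finType}.
(* Functions carry the topology of pointwise convergence. *)
Import ArrowAsProduct.
Implicit Types (q : nat -> profile R Y).

(** A profile is encoded as one real function on the disjoint union of the
action sets, with values in [0, 1], so that the Tychonoff theorem applies; the
filter is that of the tails of [A]. *)
Lemma mixed_profiles_cluster q (A : set nat) :
    (forall n, A n -> mixed_profiles (q n)) ->
    (forall n0, exists2 n, (n0 <= n)%N & A n) ->
  exists p : profile R Y, forall (delta : R) n0, 0 < delta ->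
    exists n, [/\ (n0 <= n)%N, A n &
      forall i y, `|q n i y - p i y| < delta].
Proof.
move=> hq hA.
pose I : finType := {i : 'I_N & Y i}.
pose f n : I -> R := fun t => q n (tag t) (tagged t).
pose F : set_system (I -> R) := f @ within A \oo.
have FF : ProperFilter F.
  apply: fmap_proper_filter; apply: Build_ProperFilter_ex.
  move=> B [n0 _ hB]; have [n hn An] := hA n0; exists n; exact: hB.
have hcomp := @tychonoff I (fun=> R) (fun=> `[0, 1]%classic)
  (fun=> @segment_compact R 0 1).
have hF : F [set g | forall t, `[0, 1]%classic (g t)].
  exists 0%N => // n _ An t /=; rewrite in_itv /=.
  have hs := hq n An (tag t); have [h0 _] := hs.
  by apply/andP; split; [exact: h0|exact: simplex_le1].
have [g [_ hg]] := hcomp F FF hF.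
exists (fun i => [ffun y => g (Tagged (fun i => Y i : Type) y)]) => delta n0 d0.
have hBt (t : I) : nbhs g [set h : I -> R | `|h t - g t| < delta].
  have /cvgrPdist_lt/(_ _ d0) := @proj_continuous I (fun=> R) t g.
  by apply: filterS => h /=; rewrite distrC.
have hB := filter_forall (nbhs_filter g) hBt.
have hA' : F (f @` [set n | (n0 <= n)%N /\ A n]).
  by exists n0 => // n hn An; exists n.
have [_ [[n [hn An] <-] hnear]] := hg _ _ hA' hB.
exists n; split => // i y; rewrite ffunE.
exact: (hnear (Tagged (fun i => Y i : Type) y)).
Qed.

Lemma mixed_profiles_closed (p : profile R Y) :
    (forall delta : R, 0 < delta ->
      exists2 p', mixed_profiles p' & forall i y, `|p' i y - p i y| < delta) ->
  mixed_profiles p.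
Proof.
move=> hp i; split.
  move=> y; rewrite leNgt; apply/negP => pneg.
  have npos : 0 < - p i y by rewrite oppr_gt0.
  have [p' hp' hd] := hp _ npos; have [h0 _] := hp' i.
  by have := h0 y; have := hd i y; rewrite ltr_norml; lra.
apply/eqP; rewrite -subr_eq0 -normr_eq0 eq_le normr_ge0 andbT.
apply/ler_addgt0Pr => e e0; rewrite add0r.
have K0 : 0 < #|Y i|%:R + 1 :> R by rewrite ltr_wpDl.
have [p' hp' hd] := hp (e / (#|Y i|%:R + 1)) (divr_gt0 e0 K0).
have [_ <-] := hp' i; rewrite -sumrB; apply: le_trans (ler_norm_sum _ _ _) _.
apply: le_trans (_ : \sum_(y : Y i) e / (#|Y i|%:R + 1) <= _).
  by apply: ler_sum => y _; rewrite distrC ltW.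
rewrite sumr_const -[leLHS]mulr_natl mulrA ler_pdivrMr // mulrC ler_wpM2l // ?ltW //.
by rewrite ltrDl.
Qed.

Lemma euclidean_dist_near (p : profile R Y) (eps : R) : 0 < eps ->
  exists2 delta, 0 < delta & forall p' : profile R Y,
    (forall i y, `|p' i y - p i y| < delta) -> euclidean_dist p' p < eps.
Proof.
move=> e0; pose K : R := (\sum_i #|Y i|)%:R + 1.
have K1 : 1 <= K by rewrite lerDr.
have K0 : 0 < K by lra.
exists (eps / K); first by rewrite divr_gt0.
move=> p' hd; rewrite /euclidean_dist -[ltRHS](ger0_norm (ltW e0)).
rewrite -sqrtr_sqr ltr_sqrt ?exprn_gt0 //.
apply: le_lt_trans (_ : \sum_i \sum_(y : Y i) (eps / K) ^+ 2 < _).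
  apply: ler_sum => i _; apply: ler_sum => y _.
  rewrite -real_normK ?num_real //; apply: lerXn2r; last exact/ltW/hd.
    by rewrite nnegrE.
  by rewrite nnegrE divr_ge0 // ltW.
under eq_bigr do rewrite sumr_const.
rewrite sumrMnr -[ltLHS]mulr_natl expr_div_n mulrA ltr_pdivrMr ?exprn_gt0 //.
rewrite [ltRHS]mulrC ltr_pM2r ?exprn_gt0 //.
apply: lt_le_trans (_ : K <= _); first by rewrite /K ltrDl.
by rewrite expr2 ler_peMr // ltW.
Qed.

(** If the distance stayed above [eps] infinitely often, a cluster point of those
rounds would be an equilibrium within [eps] of some of them.  In particular an
equilibrium exists, so that the distance is eventually finite. *)
Lemma gain_vanishing_dist_nash (u : 'I_N -> pure_profile Y -> R)
    (P : pure_profile Y -> R) q :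
    (forall i (y : pure_profile Y) (a a' : Y i),
       u i (play y a') - u i (play y a) = P (play y a') - P (play y a)) ->
    (forall n, (1 <= n)%N -> mixed_profiles (q n)) ->
    (forall i (eps : R), 0 < eps -> \forall n \near \oo,
       forall s : {ffun Y i -> R}, simplex s ->
         deviation_gain P (q n) s <= eps) ->
  dist_to_set (q n) (nash_equilibria u) @[n --> \oo] --> 0%:E.
Proof.
move=> hP hq hgain.
have hlt (eps : R) : 0 < eps -> \forall n \near \oo,
    (dist_to_set (q n) (nash_equilibria u) < eps%:E)%E.
  move=> e0; apply: contrapT => hno.
  pose A := [set n | (1 <= n)%N /\
    (eps%:E <= dist_to_set (q n) (nash_equilibria u))%E].
  have hA n0 : exists2 n, (n0 <= n)%N & A n.
    apply: contrapT => h; apply: hno; exists n0.+1 => // n /= hn.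
    rewrite ltNge; apply/negP => hle; apply: h; exists n; first exact: ltnW.
    by split => //; exact: leq_ltn_trans hn.
  have hAq n : A n -> mixed_profiles (q n) by move=> [n1 _]; exact: hq.
  have [p hp] := mixed_profiles_cluster hAq hA.
  have hpm : mixed_profiles p.
    apply: mixed_profiles_closed => delta d0.
    by have [n [_ An hd]] := hp delta 0%N d0; exists (q n) => //; exact: hAq.
  have hpN : nash_equilibria u p.
    split => // i s hs; rewrite -subr_le0.
    rewrite -/(deviation_gain (u i) p s) (potential_deviation_gain (@hP i)) //.
    apply/ler_addgt0Pr => e eg0; rewrite add0r.
    have M0 := utility_mass_ge0 P.
    set K := 2 * utility_mass P * N%:R.
    have K0 : 0 <= K by rewrite !mulr_ge0.
    have K10 : 0 < 2 * (K + 1) by lra.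
    have e20 : 0 < e / 2 by lra.
    (* A late round this close to p has gain at most e / 2, and moving to p adds
       at most another K * (e / (2 * (K + 1))) <= e / 2. *)
    have [n0 _ hn0] := hgain i _ e20.
    have [n [hn An hd]] := hp (e / (2 * (K + 1))) n0 (divr_gt0 eg0 K10).
    have := deviation_gain_lipschitz P (unit_bounded_mixed (hAq n An))
      (unit_bounded_mixed hpm) hs (fun i y => ltW (hd i y)).
    rewrite sumr_const card_ord -[_ *+ N]mulr_natl mulrA -/K.
    rewrite ler_norml => /andP[hlo _].
    have := hn0 n hn s hs.
    have : K * (e / (2 * (K + 1))) <= e / 2.
      by rewrite mulrA ler_pdivrMr //; nra.
    lra.
  have [delta d0 hdist] := euclidean_dist_near p e0.
  have [n [_ [_ hle] hd]] := hp delta 0%N d0.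
  have hlt := hdist _ hd.
  have : (dist_to_set (q n) (nash_equilibria u) <=
      (euclidean_dist (q n) p)%:E)%E.
    by apply: ereal_inf_lbound; exists p.
  by move=> /(le_trans hle); rewrite lee_fin leNgt hlt.
have hge n : (0%:E <= dist_to_set (q n) (nash_equilibria u))%E.
  by apply: le_ereal_inf_tmp => _ [p _ <-]; rewrite lee_fin sqrtr_ge0.
move=> B /nbhs_EFin/nbhs_ballP[e /= e0 hB].
have := hlt e e0; apply: filterS => n hn.
have := hge n; move: hn => /=.
case: (dist_to_set _ _) => [r| |] //=; rewrite !lte_fin !lee_fin => re r0.
by apply: hB; rewrite -ball_normE /ball_ /= sub0r normrN ger0_norm.
Qed.

End NashLimit.

(** * Almost sure convergence *)

Theorem theorem7p1 (R : realType) (N : nat) (Y : 'I_N -> finType)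
  (u : 'I_N -> pure_profile Y -> R)
  (d : measure_display) (Omega : measurableType d) (Pr : probability Omega R)
  (X : 'I_N -> nat -> {RV Pr >-> bool})
  (sigma : nat -> Omega -> profile R Y)
  (hpot : is_potential_game u)
  (hX1 : forall i, {ae Pr, forall w, X i 1%N w})
  (hfp : {ae Pr, forall w,
     async_fictitious_play u (fun i n => X i n w) (sigma ^~ w)})
  (hcount : forall i, {ae Pr, forall w,
     activity_count (fun j m => X j m w) i n @[n --> \oo] --> \oo})
  (hratio : forall i j, {ae Pr, forall w,
     ((activity_count (fun k m => X k m w) i n)%:R /
      (activity_count (fun k m => X k m w) j n)%:R : R) @[n --> \oo]
     --> (1 : R)}) :
  {ae Pr, forall w,
     dist_to_set (empirical (fun i m => X i m w) (sigma ^~ w) n)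
       (nash_equilibria u) @[n --> \oo] --> 0%:E}.
Proof.
have [P hP] := hpot.
have haX1 : {ae Pr, forall w, forall i, X i 1%N w}.
  exact: filter_forall.
have haN : {ae Pr, forall w, forall i,
    activity_count (fun j m => X j m w) i n @[n --> \oo] --> \oo}.
  exact: filter_forall.
have haR : {ae Pr, forall w, forall i j,
     ((activity_count (fun k m => X k m w) i n)%:R /
      (activity_count (fun k m => X k m w) j n)%:R : R) @[n --> \oo]
     --> (1 : R)}.
  by apply: filter_forall => i; apply: filter_forall => j.
apply: filterS (filterI (filterI haX1 hfp) (filterI haN haR)).
move=> w [[hX1w hfpw] [hNw hRw]].
apply: (gain_vanishing_dist_nash hP).
  by move=> n n1; apply: empirical_mixed => //; case: hfpw.
move=> i eps eps0; apply: (gain_vanishes hP hX1w hfpw) => //.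
  move=> j A; have /cvgnyPgt/(_ A) [n0 _ hn0] := hNw j.
  by exists n0; exact: hn0 (leqnn n0).
move=> delta j k delta0.
have /cvgrPdist_lt/(_ _ delta0) h := hRw j k.
have h1 : \forall n \near \oo, (1 <= n)%N by exists 1%N.
apply: filterS (filterI h1 h) => n [n1 hn].
have ck0 : 0 < (activity_count (fun k m => X k m w) k n)%:R :> R.
  by rewrite ltr0n; apply: activity_count_gt0.
rewrite -ler_pdivrMr //; move: hn; rewrite ltr_norml; lra.
Qed.
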